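(* Let $\mathbf n=(\mathbf n(c),c\ge 0)$ be degree statistics, and let $(T,V)$ be a uniformly random element of $\mathcal T_{\mathbf n}^{\bullet}$. Then for all $\beta>17^{3/2}$, $$\mathbf P\left\{|V|>\beta\frac{|\mathbf n|_1}{(|\mathbf n|_2^2-\mathbf n(1))^{1/2}}\right\}\le \exp\left(-\frac{\beta^{1/3}}{3}\,\frac{|\mathbf n|_1}{(|\mathbf n|_2^2-\mathbf n(1))^{1/2}}\right)+2\exp\left(-\frac{\beta^{2/3}}{24}\right),$$ and if $\mathbf n(1)=0$ then for all integers $\ell\ge 1$, $$\mathbf P\{|V|\ge \ell\}\le \exp\left(-\frac{\ell^2}{2|\mathbf n|_1}\right).$$
   Context: A plane tree is a finite rooted tree in which the children of each node are ordered from left to right. The degree of a node is its number of children. The degree statistics of a plane tree $t$ is the sequence $(\mathbf n_t(c),c\ge0)$ where $\mathbf n_t(c)$ is the number of nodes of $t$ with exactly $c$ children. A sequence $\mathbf n=(\mathbf n(c),c\ge 0)$ of non-negative integers with finite sum is called degree statistics if it is the degree statistics of some plane tree, equivalently if $\sum_{c\ge0}\mathbf n(c)=1+\sum_{c\ge0}c\,\mathbf n(c)$. $\mathcal T_{\mathbf n}$ is the set of plane trees with degree statistics $\mathbf n$, and $\mathcal T_{\mathbf n}^{\bullet}=\{(t,v): t\in\mathcal T_{\mathbf n},\ v \text{ a node of } t\}$. The height $|v|$ of a node $v$ is its graph distance to the root. For $p>0$, $|\mathbf n|_p=\left(\sum_{c\ge0}c^p\,\mathbf n(c)\right)^{1/p}$.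 Conventions: the quotient $|\mathbf n|_1/(|\mathbf n|_2^2-\mathbf n(1))^{1/2}$ is read as $+\infty$ when its denominator is $0$; also $\ell^2/(2|\mathbf n|_1)$ is read as $+\infty$ when $|\mathbf n|_1=0$; and $\exp(-\infty)=0$. *)

(* Defs.v *)
From HB Require Import structures.
From mathcomp Require Import all_boot all_order all_algebra.
From mathcomp Require Import finmap.
From mathcomp Require Import all_classical all_reals all_analysis.

Set Implicit Arguments.
Unset Strict Implicit.
Unset Printing Implicit Defensive.

Import Order.TTheory GRing.Theory Num.Theory.
Import numFieldNormedType.Exports.

Local Open Scope classical_set_scope.
Local Open Scope ring_scope.

Inductive plane_tree := PNode of seq plane_tree.

Definition children (t : plane_tree) : seq plane_tree :=
  let: PNode ts := t in ts.

(* plane_tree needs a choiceType structure, for the cardinality of a finite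
   set of trees. *)
Fixpoint gentree_of (t : plane_tree) : GenTree.tree void :=
  let: PNode ts := t in GenTree.Node 0 (map gentree_of ts).

Fixpoint of_gentree (g : GenTree.tree void) : plane_tree :=
  match g with
  | GenTree.Leaf _ => PNode [::]
  | GenTree.Node _ gs => PNode (map of_gentree gs)
  end.

Fixpoint gentree_ofK (t : plane_tree) : of_gentree (gentree_of t) = t.
Proof.
case: t => ts /=; congr PNode.
by elim: ts => //= t ts ->; rewrite gentree_ofK.
Qed.

HB.instance Definition _ := Countable.copy plane_tree
  (can_type (gentree_ofK : cancel gentree_of of_gentree)).

(* A node is given by its Ulam-Harris address, i.e. the list of the (0-based)
   child indices met on the path from the root to it; [::] is the root. *)
Definition node := seq nat.

Fixpoint nodes (t : plane_tree) : seq node :=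
  let: PNode ts := t in
  let ns := map nodes ts in
  [::] :: [seq i :: v | i <- iota 0 (size ns), v <- nth [::] ns i].

Lemma uniq_nodes : forall t, uniq (nodes t).
Proof.
fix IH 1; case=> ts /=; apply/andP; split.
  by apply/negP => /allpairsPdep[i [v []]].
have H : all uniq (map nodes ts) by elim: ts => //= t ts ->; rewrite IH.
apply: allpairs_uniq_dep; first exact: iota_uniq.
  by move=> i; rewrite mem_iota => /andP[_ hi]; apply: (allP H); exact: mem_nth.
by move=> [i v] [j w] _ _ /= [-> ->].
Qed.

(* The path from the root to v has one edge per entry of the address. *)
Definition height (v : node) : nat := size v.

(* Only meaningful for v \in nodes t; the default tree is never reached then. *)
Definition subtree (t : plane_tree) (v : node) : plane_tree :=
  foldl (fun u i => nth (PNode [::]) (children u) i) t v.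

Definition degree (t : plane_tree) (v : node) : nat :=
  size (children (subtree t v)).

Definition degree_stats_of (t : plane_tree) (c : nat) : nat :=
  count (fun v => degree t v == c) (nodes t).

Definition plane_trees (n : nat -> nat) : set plane_tree :=
  [set t | degree_stats_of t =1 n].

Definition is_degree_stats (n : nat -> nat) : Prop :=
  exists t, plane_trees n t.

Definition pointed_plane_trees (n : nat -> nat) : set (plane_tree * node) :=
  [set tv | plane_trees n tv.1 /\ tv.2 \in nodes tv.1].

Lemma size_nodes t0 t : degree_stats_of t =1 degree_stats_of t0 ->
  size (nodes t) = size (nodes t0).
Proof.
move=> e.
have /perm_size : perm_eq (map (degree t) (nodes t))
                          (map (degree t0) (nodes t0)).
  by apply/allP => c _ /=; rewrite !count_map; apply/eqP; exact: (e c).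
by rewrite !size_map.
Qed.

Lemma nodesE ts : size (nodes (PNode ts)) = (sumn (map (size \o nodes) ts)).+1.
Proof.
rewrite /= size_allpairs_dep; congr _.+1; congr sumn.
rewrite (map_comp size nodes) -[in RHS](mkseq_nth [::] (map nodes ts)) /mkseq.
by rewrite -[in RHS]map_comp.
Qed.

Lemma finite_seqs (A : set plane_tree) N : finite_set A ->
  finite_set
    [set s : seq plane_tree | (size s <= N)%N /\ forall t, t \in s -> A t].
Proof.
move=> fA; elim: N => [|N IH].
  apply: (@sub_finite_set _ _ [set [::]]) => //; first by case=> //= a s [].
apply: (@sub_finite_set _ _ ([set [::]] `|` (fun p => p.1 :: p.2) @` (A `*` [set s : seq plane_tree | (size s <= N)%N /\ forall t, t \in s -> A t]))).
  case=> [|a s] /=; first by left.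
  move=> [sN sA]; right; exists (a, s) => //=; split; first by apply: sA; rewrite mem_head.
  by split=> // t ts; apply: sA; rewrite in_cons ts orbT.
by rewrite finite_setU; split=> //; apply: finite_image; apply: finite_setX.
Qed.

Lemma finite_bounded N : finite_set [set t | (size (nodes t) <= N)%N].
Proof.
elim: N => [|N IH].
  by apply: (@sub_finite_set _ _ set0) => //; case=> ts; rewrite /mkset nodesE.
apply: sub_finite_set (finite_image PNode (finite_seqs N IH)).
case=> ts; rewrite /mkset nodesE ltnS => h; exists ts => //; split.
  apply: leq_trans h; elim: ts => //= -[us] ts ih; rewrite -/(nodes _) .
  by rewrite (nodesE us) addSn ltnS (leq_trans ih) ?leq_addl.
move=> t /= tts; apply: leq_trans h.
elim: ts tts => //= a ts ih; rewrite in_cons => /orP[/eqP <-|/ih]; first by rewrite leq_addr.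
by move/leq_trans; apply; rewrite leq_addl.
Qed.

Lemma finite_pointed_plane_trees n : finite_set (pointed_plane_trees n).
Proof.
have [[t0 h0]|h] := pselect (is_degree_stats n); last first.
  apply: (@sub_finite_set _ _ set0) => // -[t v] /= [ht _].
  by apply: h; exists t.
have fT : finite_set (plane_trees n).
  apply: sub_finite_set (finite_bounded (size (nodes t0))) => t ht /=.
  by rewrite (@size_nodes t0 t) // => c; rewrite ht h0.
apply: (@sub_finite_set _ _ (\bigcup_(t in plane_trees n)
                               ((fun v => (t, v)) @` [set` nodes t]))).
  by move=> [t v] /= [ht hv]; exists t => //; exists v.
by apply: bigcup_finite => // t _; apply: finite_image; exact: finite_seq.
Qed.

Definition pnorm (R : realType) (p : R) (n : nat -> nat) : R :=
  limn (series (fun c : nat => c%:R `^ p * (n c)%:R)) `^ p^-1.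

(* Quotient of nonnegative reals, equal to +oo when the denominator is 0
   (even if the numerator is 0). *)
Definition quot_oo (R : realType) (x y : R) : \bar R :=
  if y == 0 then +oo%E else (x / y)%:E.

Definition height_scale (R : realType) (n : nat -> nat) : \bar R :=
  quot_oo (pnorm 1 n) (Num.sqrt (pnorm (2 : R) n ^+ 2 - (n 1%N)%:R)).

(* X is a uniformly random element of the finite set S (#|` fset_set S| is its
   cardinality).  Only the events X = x are required to be measurable, as E
   carries no sigma-algebra. *)
Definition uniformly_random (R : realType) (d : measure_display)
    (Omega : measurableType d) (P : probability Omega R) (E : choiceType)
    (S : set E) (X : Omega -> E) : Prop :=
  (forall w, S (X w)) /\
  forall x, S x -> measurable (X @^-1` [set x]) /\
    P (X @^-1` [set x]) = (#|` fset_set S|%:R^-1)%:E.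

(* Main.v *)
Require Import Defs.
From HB Require Import structures.
From mathcomp Require Import all_boot all_order all_algebra.
From mathcomp Require Import finmap.
From mathcomp Require Import all_classical all_reals all_analysis.
From mathcomp Require Import zify ring lra.

Set Implicit Arguments.
Unset Strict Implicit.
Unset Printing Implicit Defensive.

Import Order.TTheory GRing.Theory Num.Theory.
Import numFieldNormedType.Exports.

Local Open Scope classical_set_scope.
Local Open Scope ring_scope.

(** The law of the height of [V] is explicit. Let [d_1, ..., d_N] be the
    degrees prescribed by [n], so [N = 1 + |n|_1]. Then [P(|V| >= h)] is the
    [h]-th elementary symmetric mean [e_h(d) / 'C(N, h)].

    To see it, generalise from trees to forests of [k] trees with statistics
    [m], whose first tree carries a marked node at height at least [h]. If [h]
    is positive, the marked node is a descendant of one of the [c] children of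
    the first root. Deleting this root leaves a forest of [k + c - 1] trees,
    and rotating the forest puts the tree of the mark in first position,
    whichever child was chosen. Hence the count for [(h + 1, k, m)] is the sum
    over [c] of [c] times the count for [(h, k + c - 1, m - delta_c)]
    ([marked_forestsS]). At [h = 0] it is the multinomial coefficient of [m]
    ([marked_forests0]), and the recursion is the one satisfied by the
    coefficients of [prod_c (1 + c X)^m(c)], whose derivative is
    [sum_c c m(c) prod_j (1 + j X)^(m - delta_c)(j)]. The outcome is [marked_forests_coef].

    If no degree is [1], then each of [h] chosen positive degrees is at least
    [2], so [(h + 1) e_(h+1) <= (|n|_1 - 2 h) e_h]. Therefore [P(|V| >= h)] is
    at most the product over [i < h] of [(|n|_1 - 2 i) / (N - i)], each factor
    of which is at most [exp(- (i + 1) / N)]. This is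
    [marked_forests_no_unary].

    In general, averaging [P(|V| >= h)] over a binomial [h] with parameters
    [N] and [u] gives [prod_i (1 + u (d_i - 1))]. With [u = l / (2 N)] the
    binomial variable has mean [l / 2], and as [P(|V| >= h)] decreases with
    [h] this yields [P(|V| >= l) <= 2 prod_i (1 + u (d_i - 1))]
    ([marked_forests_le_prod]). Since the [d_i - 1] add up to [-1], the linear
    terms of the logarithms contribute only [- u]; the quadratic ones, coming
    from the degrees at least [2], make the product at most
    [exp(- (s - 1) / 16)] with [s = u sqrt Q] and [Q = |n|_2^2 - n(1)]
    ([prod_le_expR]). For [l] above [beta |n|_1 / sqrt Q] this [s] exceeds [beta / 3], and as
    [beta^(1/3) > 4] the result is already below the second term
    [2 exp(- beta^(2/3) / 24)] of the announced bound. *)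

(** * Forests with prescribed degree statistics *)

Definition forest_stats (f : seq plane_tree) (c : nat) : nat :=
  (\sum_(t <- f) degree_stats_of t c)%N.

Definition decr (m : nat -> nat) (c : nat) : nat -> nat :=
  fun j => (m j - (j == c))%N.

(** The list of all forests of [k] trees with statistics [m], where [M] is
    their number of nodes and [B] exceeds all degrees. A nonempty forest is
    obtained from the one left after deleting its first root: if that root has
    degree [c], its children are the first [c] trees of the smaller forest. *)
Fixpoint forests (B M k : nat) (m : nat -> nat) : seq (seq plane_tree) :=
  match M, k with
  | 0, 0 => [:: [::]]
  | M'.+1, k'.+1 =>
      [seq PNode (take c f) :: drop c f |
        c <- [seq c <- iota 0 B | (0 < m c)%N],
        f <- forests B M' (k' + c) (decr m c)]
  | _, _ => [::]
  end.

Lemma degree_stats_of_node ts c :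
  degree_stats_of (PNode ts) c = ((size ts == c) + forest_stats ts c)%N.
Proof.
rewrite /degree_stats_of /= size_map; congr addn.
rewrite count_flatten -map_comp sumnE big_map /forest_stats.
rewrite (big_nth (PNode [::])) big_mkord.
have -> : iota 0 (size ts) = index_iota 0 (size ts).
  by rewrite /index_iota subn0.
rewrite big_mkord; apply: eq_bigr => i _ /=; rewrite count_map /=.
by rewrite (nth_map (PNode [::])).
Qed.

Lemma forest_stats_cons t f c :
  forest_stats (t :: f) c = (degree_stats_of t c + forest_stats f c)%N.
Proof. by rewrite /forest_stats big_cons. Qed.

Lemma forest_stats_cat f g c :
  forest_stats (f ++ g) c = (forest_stats f c + forest_stats g c)%N.
Proof. by rewrite /forest_stats big_cat. Qed.

Lemma forest_stats_graft c f j : (c <= size f)%N ->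
  forest_stats (PNode (take c f) :: drop c f) j =
  ((j == c) + forest_stats f j)%N.
Proof.
move=> cf; rewrite forest_stats_cons degree_stats_of_node size_takel //.
by rewrite eq_sym -addnA -forest_stats_cat cat_take_drop.
Qed.

Lemma sum_decr (B : nat) (w m : nat -> nat) c : (c < B)%N -> (0 < m c)%N ->
  (\sum_(i < B) w i * decr m c i + w c = \sum_(i < B) w i * m i)%N.
Proof.
move=> cB mc; rewrite (bigD1 (Ordinal cB)) //= [RHS](bigD1 (Ordinal cB)) //=.
rewrite (eq_bigr (fun i : 'I_B => w i * m i)%N); last first.
  by move=> i /negPf h; rewrite /decr -(inj_eq val_inj) /= in h *;
    rewrite h subn0.
rewrite /decr eqxx; nia.
Qed.

Lemma total_decr (B M : nat) (m : nat -> nat) c : (c < B)%N -> (0 < m c)%N ->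
  (\sum_(i < B) m i = M.+1 -> \sum_(i < B) decr m c i = M)%N.
Proof.
move=> cB mc h; have := @sum_decr B (fun=> 1%N) m c cB mc.
rewrite (eq_bigr (fun i : 'I_B => decr m c i)); last first.
  by move=> i _; rewrite mul1n.
under [RHS]eq_bigr do rewrite mul1n.
by rewrite h addn1 => -[].
Qed.

Lemma decr_bounded B m c : (forall c, (B <= c)%N -> m c = 0%N) ->
  forall j, (B <= j)%N -> decr m c j = 0%N.
Proof. by move=> h j /h; rewrite /decr => ->. Qed.

Lemma mem_forests B M k m f :
    (forall c, (B <= c)%N -> m c = 0%N) -> (\sum_(c < B) m c = M)%N ->
  f \in forests B M k m <-> size f = k /\ forest_stats f =1 m.
Proof.
elim: M k m f => [|M IH] k m f hB hM.
  have m0 : m =1 fun=> 0%N.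
    move=> c; have [/hB //|cB] := leqP B c.
    move/eqP: hM; rewrite sum_nat_eq0 => /forallP/(_ (Ordinal cB)) /=.
    by move/eqP.
  case: k => [|k] /=.
    rewrite inE; split=> [/eqP ->|[/eqP/nilP ->]] //; split=> // c.
    by rewrite m0 /forest_stats big_nil.
  split=> // -[]; case: f => // -[ts] f _ /(_ (size ts)).
  by rewrite m0 forest_stats_cons degree_stats_of_node eqxx.
case: k => [|k] /=.
  split=> // -[/eqP/nilP -> h]; move: hM; rewrite big1 // => i _.
  by rewrite -h /forest_stats big_nil.
split.
  move=> /allpairsPdep[c [g [+ + ->]]].
  rewrite mem_filter mem_iota add0n => /andP[mc /andP[_ cB]].
  rewrite IH; last exact: total_decr; last exact: decr_bounded.
  move=> [sg hg]; have cg : (c <= size g)%N by rewrite sg leq_addl.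
  rewrite /= size_drop sg addnK; split=> // j.
  rewrite forest_stats_graft // hg /decr.
  by have [->|] := eqVneq j c => /=; lia.
case=> + hf; case: f hf => // -[ts] f hf [fk].
have hts j : m j = ((j == size ts) + forest_stats (ts ++ f) j)%N.
  rewrite -hf forest_stats_cons degree_stats_of_node forest_stats_cat eq_sym.
  lia.
have mts : (0 < m (size ts))%N by rewrite hts eqxx.
have tsB : (size ts < B)%N.
  by rewrite ltnNge; apply/negP => /hB h; rewrite h in mts.
apply/allpairsPdep; exists (size ts), (ts ++ f); split.
- by rewrite mem_filter mts mem_iota.
- rewrite IH; last exact: total_decr; last exact: decr_bounded.
  rewrite size_cat fk addnC; split=> // j; rewrite /decr hts; lia.
- by rewrite take_size_cat // drop_size_cat.
Qed.

Lemma uniq_forests B M k m :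
    (forall c, (B <= c)%N -> m c = 0%N) -> (\sum_(c < B) m c = M)%N ->
  uniq (forests B M k m).
Proof.
elim: M k m => [|M IH] [|k] m hB hM //=.
apply: allpairs_uniq_dep; first by rewrite filter_uniq ?iota_uniq.
  move=> c; rewrite mem_filter mem_iota => /andP[mc /andP[_ cB]].
  by apply: IH; [exact: decr_bounded|exact: total_decr].
have sz p : p \in [seq existT (fun=> seq plane_tree) c f
    | c <- [seq c <- iota 0 B | (0 < m c)%N],
      f <- forests B M (k + c) (decr m c)] -> (tag p <= size (tagged p))%N.
  move=> /allpairsPdep[c [f [+ + ->]]] /=.
  rewrite mem_filter mem_iota => /andP[mc /andP[_ cB]].
  rewrite mem_forests; last exact: total_decr; last exact: decr_bounded.
  by case=> -> _; rewrite leq_addl.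
move=> [c f] [d g] /sz /= cf /sz /= dg [e1 e2].
have ecd : c = d by rewrite -(size_takel cf) e1 size_takel.
by rewrite -ecd in e1 e2 *; rewrite -(cat_take_drop c f) e1 e2 cat_take_drop.
Qed.

Lemma big_forests (R : Type) (idx : R) (op : Monoid.com_law idx)
    B M k m (F : seq plane_tree -> R) :
  \big[op/idx]_(f <- forests B M.+1 k.+1 m) F f =
  \big[op/idx]_(c < B | (0 < m c)%N)
    \big[op/idx]_(f <- forests B M (k + c) (decr m c))
      F (PNode (take c f) :: drop c f).
Proof.
rewrite big_allpairs_dep big_filter.
have -> : iota 0 B = index_iota 0 B by rewrite /index_iota subn0.
by rewrite big_mkord.
Qed.

(** The last condition is the one that makes a forest of [k] trees with
    statistics [m] possible. *)
Definition stats_type (B M k : nat) (m : nat -> nat) : Prop :=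
  [/\ forall c, (B <= c)%N -> m c = 0%N, (\sum_(c < B) m c = M)%N &
      (M = k + \sum_(c < B) c * m c)%N].

Lemma stats_type_decr B M k m c : stats_type B M.+1 k.+1 m ->
  (c < B)%N -> (0 < m c)%N -> stats_type B M (k + c) (decr m c).
Proof.
move=> [hB hM hk] cB mc; split; [exact: decr_bounded|exact: total_decr|].
have h : (\sum_(i < B) i * decr m c i + c = \sum_(i < B) i * m i)%N.
  exact: (@sum_decr B id).
by apply/eqP; move: hk; rewrite -h; lia.
Qed.

(** The order of the group permuting nodes of equal degree: [M`!] divided by
    it is the multinomial coefficient of [m]. Multiplying counts by it keeps
    all identities in [nat]. *)
Definition symmetries (B : nat) (m : nat -> nat) : nat :=
  (\prod_(c < B) (m c)`!)%N.

Lemma symmetries_decr B m c : (c < B)%N -> (0 < m c)%N ->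
  (symmetries B m = m c * symmetries B (decr m c))%N.
Proof.
move=> cB mc; rewrite /symmetries (bigD1 (Ordinal cB)) //=.
rewrite [in RHS](bigD1 (Ordinal cB)) //= mulnA; congr muln.
  by rewrite /decr eqxx; case: (m c) mc => // a _; rewrite factS subn1.
apply: eq_bigr => i; rewrite -(inj_eq val_inj) /= => /negPf h.
by rewrite /decr h subn0.
Qed.

(** The number of forests of [k] trees is [k / (M + 1)] times the multinomial
    coefficient. Deleting the first root turns this into [sum_c m(c) (k - 1 +
    c) = M k], which is the relation between [k] and the total number of
    nodes; the base case is a single leaf. *)
Lemma size_forests B M k m : stats_type B M.+1 k m ->
  (size (forests B M.+1 k m) * symmetries B m = k * M`!)%N.
Proof.
elim: M k m => [|M IH] [|k] m hm; rewrite ?mul0n // -sum1_size big_forests;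
  rewrite big_distrl /=.
  have [_ h1 h2] := hm.
  have k0 : k = 0%N by lia.
  rewrite k0 in hm h2 *.
  have {}h2 : (\sum_(c < B) c * m c = 0)%N by lia.
  rewrite mul1n fact0 -[RHS]h1 big_mkcond; apply: eq_bigr => c _.
  case: posnP => // mc.
  move/eqP: h2; rewrite sum_nat_eq0 => /forallP/(_ c)/=.
  rewrite muln_eq0 [m c == _]eqn0Ngt mc orbF => /eqP c0.
  have [_ hd _] := stats_type_decr hm (ltn_ord c) mc.
  rewrite c0 /= sum1_size mul1n (symmetries_decr (ltn_ord c) mc) c0 in hd *.
  rewrite -[RHS]muln1; congr muln; apply: big1 => i _.
  by move/eqP: hd; rewrite sum_nat_eq0 => /forallP/(_ i) /= /eqP ->.
transitivity (\sum_(c < B) m c * ((k + c) * M`!))%N.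
  rewrite big_mkcond; apply: eq_bigr => c _; case: posnP => [-> //|mc].
  rewrite -(IH _ _ (stats_type_decr hm (ltn_ord c) mc)) sum1_size.
  by rewrite (symmetries_decr (ltn_ord c) mc) mulnCA.
have [_ h1 h2] := hm.
transitivity (M`! * (k * \sum_(c < B) m c + \sum_(c < B) c * m c))%N.
  rewrite !big_distrr /= -big_split big_distrr /=; apply: eq_bigr => c _; lia.
rewrite factS; nia.
Qed.

(** * Forests with a marked node in the first tree *)

Definition nodes_above (h : nat) (t : plane_tree) : nat :=
  count (fun v => (h <= height v)%N) (nodes t).

Lemma nodes_above0 t : nodes_above 0 t = (nodes_above 1 t).+1.
Proof.
case: t => ts; rewrite /nodes_above /= add1n; congr _.+1.
by apply: eq_in_count => v /allpairsPdep[i [w [_ _ ->]]].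
Qed.

Lemma nodes_aboveS h ts : nodes_above h.+1 (PNode ts) =
  (\sum_(i < size ts) nodes_above h (nth (PNode [::]) ts i))%N.
Proof.
rewrite /nodes_above /= add0n size_map count_flatten -map_comp sumnE big_map.
have -> : iota 0 (size ts) = index_iota 0 (size ts).
  by rewrite /index_iota subn0.
rewrite big_mkord; apply: eq_bigr => i _ /=; rewrite count_map /=.
by rewrite (nth_map (PNode [::])).
Qed.

Lemma leq_nodes_above h h' t : (h <= h')%N ->
  (nodes_above h' t <= nodes_above h t)%N.
Proof. by move=> hh'; apply: sub_count => v /=; exact: leq_trans. Qed.

(** Rotation preserves the statistics, so all positions in a forest play the
    same role. *)
Lemma perm_forests_rot B M k m i :
    (forall c, (B <= c)%N -> m c = 0%N) -> (\sum_(c < B) m c = M)%N ->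
  perm_eq [seq rot i f | f <- forests B M k m] (forests B M k m).
Proof.
move=> hB hM; have u := uniq_forests k hB hM.
have sub f : f \in forests B M k m -> rot i f \in forests B M k m.
  rewrite !mem_forests // size_rot => -[-> hf]; split=> // c.
  by rewrite -hf; apply: perm_big; rewrite perm_rot.
have um : uniq [seq rot i f | f <- forests B M k m].
  by rewrite map_inj_uniq //; exact: rot_inj.
apply: uniq_perm => //.
have sub' : {subset [seq rot i f | f <- forests B M k m] <= forests B M k m}.
  by move=> _ /mapP[f + ->]; exact: sub.
by have [|_ eqi] := uniq_min_size um sub'; [rewrite size_map|exact: eqi].
Qed.

Definition marked_forests (B M k : nat) (m : nat -> nat) (h : nat) : nat :=
  (\sum_(f <- forests B M k m) nodes_above h (head (PNode [::]) f))%N.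

Lemma sum_nodes_above_nth B M k m h i :
    (forall c, (B <= c)%N -> m c = 0%N) -> (\sum_(c < B) m c = M)%N ->
    (i < k)%N ->
  (\sum_(f <- forests B M k m) nodes_above h (nth (PNode [::]) f i) =
   marked_forests B M k m h)%N.
Proof.
move=> hB hM ik.
rewrite /marked_forests.
rewrite -[RHS](perm_big _ (perm_forests_rot k i hB hM)) big_map /=.
apply: eq_big_seq => f; rewrite mem_forests // => -[sf _].
by rewrite /rot (drop_nth (PNode [::])) ?sf.
Qed.

(** The marked node is above one of the [c] children of the first root, and by
    rotation every child contributes as much as the first one. *)
Lemma marked_forestsS B M k m h : stats_type B M.+1 k.+1 m ->
  (marked_forests B M.+1 k.+1 m h.+1 =
   \sum_(c < B | 0 < m c) c * marked_forests B M (k + c) (decr m c) h)%N.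
Proof.
move=> hm; rewrite [LHS]big_forests; apply: eq_bigr => c mc.
have [hB hM _] := stats_type_decr hm (ltn_ord c) mc.
transitivity (\sum_(f <- forests B M (k + c) (decr m c)) \sum_(i < c)
    nodes_above h (nth (PNode [::]) f i))%N.
  apply: eq_big_seq => f; rewrite mem_forests // => -[sf _].
  rewrite nodes_aboveS size_takel ?sf ?leq_addl //.
  by apply: eq_bigr => i _; rewrite nth_take.
rewrite exchange_big /=.
rewrite (eq_bigr (fun=> marked_forests B M (k + c) (decr m c) h)).
  by rewrite sum_nat_const card_ord.
move=> i _; apply: sum_nodes_above_nth => //.
by rewrite (leq_trans (ltn_ord i)) ?leq_addl.
Qed.

(** Either the first root is marked, a case counted by [size_forests], or
    [marked_forestsS] applies: the fraction [k / M] of the multinomial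
    coefficient from the former and [sum_c c m(c) / M] from the latter add up
    to [1]. *)
Lemma marked_forests0 B M k m : stats_type B M k.+1 m ->
  (marked_forests B M k.+1 m 0 * symmetries B m = M`!)%N.
Proof.
elim: M k m => [|M IH] k m hm.
  by case: hm => _ _; rewrite addSn.
have -> : (marked_forests B M.+1 k.+1 m 0 =
    size (forests B M.+1 k.+1 m) + marked_forests B M.+1 k.+1 m 1)%N.
  rewrite /marked_forests (eq_bigr _ (fun f _ => nodes_above0 _)).
  by rewrite -sum1_size -big_split.
rewrite mulnDl size_forests // marked_forestsS // big_distrl /=.
transitivity (k.+1 * M`! + \sum_(c < B) c * m c * M`!)%N.
  congr addn; rewrite big_mkcond; apply: eq_bigr => c _.
  case: posnP => [->|mc]; first by rewrite muln0.
  have [->|c0] := posnP c; first by rewrite !mul0n.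
  rewrite (symmetries_decr (ltn_ord c) mc).
  have := stats_type_decr hm (ltn_ord c) mc.
  by rewrite -(prednK c0) addnS => /IH <-; lia.
by have [_ _ h] := hm; rewrite -big_distrl -mulnDl /= -h factS.
Qed.

(** * Marked nodes and elementary symmetric polynomials *)

(** The coefficient of degree [h] is the [h]-th elementary symmetric
    polynomial of the degrees, where [c] is repeated [m c] times. *)
Definition spine_poly (R : realFieldType) (B : nat) (m : nat -> nat) :
    {poly R} :=
  \prod_(c < B) (1 + c%:R *: 'X) ^+ m c.

Lemma spine_polyS (R : realFieldType) B (m : nat -> nat) : spine_poly R B.+1 m =
  spine_poly R B m * (1 + B%:R *: 'X) ^+ m B.
Proof. by rewrite /spine_poly big_ord_recr. Qed.

Lemma deriv_spine_poly (R : realFieldType) B (m : nat -> nat) :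
  (spine_poly R B m)^`() =
  \sum_(c < B) (c * m c)%:R *: spine_poly R B (decr m c).
Proof.
elim: B => [|B IH].
  by rewrite big_ord0 /spine_poly big_ord0 derivC.
rewrite spine_polyS derivM IH big_ord_recr /=; congr +%R.
  rewrite big_distrl /=; apply: eq_bigr => c _.
  by rewrite spine_polyS /decr gtn_eqF // subn0 scalerAl.
have -> : spine_poly R B.+1 (decr m B) =
    spine_poly R B m * (1 + B%:R *: 'X) ^+ (m B).-1.
  rewrite spine_polyS /decr eqxx subn1; congr (_ * _).
  by apply: eq_bigr => c _; rewrite ltn_eqF // subn0.
rewrite deriv_exp derivD derivZ derivX derivC add0r -scalerAl mul1r.
by rewrite -scaler_nat scalerA -scalerAr -natrM mulnC.
Qed.

Lemma coef_spine_polyS (R : realFieldType) B (m : nat -> nat) h :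
  h.+1%:R * (spine_poly R B m)`_h.+1 =
  \sum_(c < B) (c * m c)%:R * (spine_poly R B (decr m c))`_h.
Proof.
rewrite mulr_natl -coef_deriv deriv_spine_poly coef_sum.
by apply: eq_bigr => c _; rewrite coefZ.
Qed.

Lemma coef_spine_poly0 (R : realFieldType) B (m : nat -> nat) :
  (spine_poly R B m)`_0 = 1.
Proof.
rewrite -horner_coef0 /spine_poly horner_prod big1 // => c _.
by rewrite horner_exp hornerD hornerZ hornerX mulr0 hornerC addr0 expr1n.
Qed.

Lemma size_spine_poly (R : realFieldType) B (m : nat -> nat) :
  (size (spine_poly R B m) <= (\sum_(c < B) m c).+1)%N.
Proof.
elim: B => [|B IH]; first by rewrite /spine_poly !big_ord0 size_poly1.
rewrite spine_polyS big_ord_recr /=.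
apply: leq_trans (size_polyMleq _ _) _.
set q : {poly R} := 1 + B%:R *: 'X.
have h1 : (size q <= 2)%N.
  apply: leq_trans (size_polyD _ _) _; rewrite geq_max size_poly1 /=.
  by apply: leq_trans (size_scale_leq _ _) _; rewrite size_polyX.
have h2 : (size (q ^+ m B) <= (m B).+1)%N.
  apply: leq_trans (size_poly_exp_leq _ _) _.
  by rewrite ltnS -[leqRHS]mul1n leq_mul2r -subn1 leq_subLR h1 orbT.
by rewrite -subn1 leq_subLR (leq_trans (leq_add IH h2)) // addSn addnS.
Qed.

(** Homogenise [spine_poly] at [u] and [1 - u]; there are [M] factors. *)
Lemma spine_poly_binomial (R : realFieldType) B (m : nat -> nat) (u : R) :
  u != 1 ->
  let M := (\sum_(c < B) m c)%N in
  \sum_(h < M.+1) (spine_poly R B m)`_h * (u ^+ h * (1 - u) ^+ (M - h)) =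
  \prod_(c < B) (1 + u * (c%:R - 1)) ^+ m c.
Proof.
move=> u1 M; have v0 : 1 - u != 0 by rewrite subr_eq0 eq_sym.
transitivity ((1 - u) ^+ M * (spine_poly R B m).[u / (1 - u)]).
  rewrite (horner_coef_wide _ (size_spine_poly _ _ _)) big_distrr /=.
  apply: eq_bigr => h _; have hM : (h <= M)%N by rewrite -ltnS.
  rewrite expr_div_n -[in RHS](subnK hM) exprD.
  by field; rewrite expf_neq0.
rewrite /spine_poly horner_prod /M -prodrXr -big_split /=.
apply: eq_bigr => c _; rewrite horner_exp -exprMn; congr (_ ^+ _).
by rewrite hornerD hornerZ hornerX hornerC; field.
Qed.

(** Among the marked forests, the fraction whose mark has height at least [h]
    is [e_h / 'C(M, h)]: both sides obey the same recursion in [h], the left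
    one by [marked_forestsS] and the right one by [deriv_spine_poly]. *)
Lemma marked_forests_coef (R : realFieldType) B M k m h :
    stats_type B M k.+1 m ->
  (marked_forests B M k.+1 m h * 'C(M, h))%:R =
  (marked_forests B M k.+1 m 0)%:R * (spine_poly R B m)`_h.
Proof.
have A0 m' : (symmetries B m')%:R != 0 :> R.
  by rewrite pnatr_eq0 -lt0n prodn_gt0 // => c; rewrite fact_gt0.
suff H : forall h M k m, stats_type B M k.+1 m ->
    (marked_forests B M k.+1 m h * symmetries B m * 'C(M, h))%:R =
    (M`!)%:R * (spine_poly R B m)`_h.
  move=> hm; apply: (mulIf (A0 m)); rewrite -natrM mulnAC H //.
  by rewrite mulrAC -natrM marked_forests0.
move=> {h M k m}; elim=> [|h IH] M k m hm.
  by rewrite bin0 muln1 marked_forests0 // coef_spine_poly0 mulr1.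
have [M' eM] : exists M', M = M'.+1.
  by case: hm => _ _ ->; rewrite addSn; eexists.
rewrite eM {M eM} in hm *.
have h0 : h.+1%:R != 0 :> R by rewrite pnatr_eq0.
apply: (mulfI h0); rewrite mulrCA coef_spine_polyS -natrM mulnCA.
rewrite -mul_bin_diag marked_forestsS //= !big_distrl big_distrr natr_sum /=.
rewrite big_mkcond; apply: eq_bigr => c _.
case: posnP => [->|mc]; first by rewrite muln0 mul0r mulr0.
have [->|c0] := posnP c; first by rewrite !mul0n mul0r mulr0.
rewrite (symmetries_decr (ltn_ord c) mc).
have := stats_type_decr hm (ltn_ord c) mc.
have -> : (k + c = (k + c.-1).+1)%N by rewrite -addnS prednK.
move=> /IH h1.
have -> x : (M'.+1`!)%:R * ((c * m c)%:R * x) =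
    (M'.+1 * (c * m c))%:R * ((M'`!)%:R * x) :> R by rewrite factS !natrM; ring.
rewrite -h1 -natrM; congr _%:R; lia.
Qed.

Lemma binomial_mean (R : realFieldType) M (u : R) :
  \sum_(h < M.+1) h%:R * ('C(M, h)%:R * (u ^+ h * (1 - u) ^+ (M - h))) =
  M%:R * u.
Proof.
case: M => [|M]; first by rewrite big_ord1 !mul0r.
rewrite big_ord_recl /= mul0r add0r.
transitivity (M.+1%:R * u * (u + (1 - u)) ^+ M); last first.
  by rewrite addrC subrK expr1n mulr1.
rewrite (addrC u) exprDn big_distrr /=; apply: eq_bigr => i _.
rewrite mulrA -natrM /bump add1n -mul_bin_diag natrM subSS exprS /=.
rewrite -[_ *+ 'C(M, i)]mulr_natl.
ring.
Qed.

Lemma binomial_total (R : realFieldType) M (u : R) :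
  \sum_(h < M.+1) ('C(M, h)%:R * (u ^+ h * (1 - u) ^+ (M - h))) = 1.
Proof.
rewrite -[RHS](expr1n _ M) -[X in X ^+ _](subrK u 1) exprDn.
apply: eq_bigr => i _.
by rewrite -[_ *+ 'C(M, i)]mulr_natl; ring.
Qed.

(** A decreasing sequence [w] of nonnegative numbers satisfies
    [w_l (1 - h / l) <= w_h] for all [h]. Average this inequality over a binomial [h] with
    parameters [M] and [u]. *)
Lemma marked_forests_le_prod (R : realFieldType) B M k m l (u : R) :
    stats_type B M k.+1 m -> 0 <= u -> u < 1 -> (0 < l)%N ->
  (marked_forests B M k.+1 m l)%:R * (1 - M%:R * u / l%:R) <=
  (marked_forests B M k.+1 m 0)%:R *
    \prod_(c < B) (1 + u * (c%:R - 1)) ^+ m c.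
Proof.
move=> hm u0 u1 l0; have [_ hM _] := hm.
rewrite -spine_poly_binomial ?lt_eqF // hM big_distrr /=.
have -> : 1 - M%:R * u / l%:R = \sum_(h < M.+1)
    ((1 - h%:R / l%:R) * ('C(M, h)%:R * (u ^+ h * (1 - u) ^+ (M - h)))) :> R.
  rewrite -[X in X - _](binomial_total M u) -binomial_mean big_distrl -sumrB /=.
  by apply: eq_bigr => h _; ring.
rewrite big_distrr /=; apply: ler_sum => h _.
rewrite [leRHS]mulrA -marked_forests_coef // natrM.
set b := u ^+ h * _; set C := 'C(M, h)%:R.
set w := (marked_forests _ _ _ _ l)%:R.
have b0 : 0 <= C * b.
  by rewrite !mulr_ge0 // exprn_ge0 // subr_ge0 ltW.
rewrite mulrA -[leRHS]mulrA; apply: ler_wpM2r => //.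
rewrite {}/w.
have l0' : 0 < l%:R :> R by rewrite ltr0n.
have [hl|lh] := leqP h l.
  apply: (@le_trans _ _ (marked_forests B M k.+1 m l)%:R).
    by rewrite ler_piMr // gerBl divr_ge0.
  by rewrite ler_nat; apply: leq_sum => f _; exact: leq_nodes_above.
apply: (@le_trans _ _ 0) => //; rewrite mulr_ge0_le0 // subr_le0.
by rewrite ler_pdivlMr // mul1r ler_nat ltnW.
Qed.

(** * Tail estimates *)

(** Once [h] positive degrees are chosen, their sum is at least [a * h], so
    what remains for the next choice is at most [sum_c c m(c) - a h]. The case
    [a = 1] bounds heights by the number of non-root nodes; [a = 2] is the
    case without unary nodes. *)
Lemma coef_spine_poly_le (R : realFieldType) B (m : nat -> nat) a h :
    (forall c, (0 < c)%N -> (0 < m c)%N -> (a <= c)%N) ->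
  (h`!)%:R * (spine_poly R B m)`_h <=
  (\prod_(i < h) (\sum_(c < B) c * m c - a * i))%N%:R.
Proof.
elim: h m => [|h IH] m ha.
  by rewrite big_ord0 coef_spine_poly0 mulr1.
rewrite factS mulnC natrM -mulrA coef_spine_polyS big_distrr /=.
apply: (@le_trans _ _ (\sum_(c < B) (c * m c)%:R *
    (\prod_(i < h) (\sum_(c < B) c * m c - a * i.+1))%N%:R)); last first.
  by rewrite -big_distrl /= -natr_sum -natrM big_ord_recl muln0 subn0.
apply: ler_sum => c _; rewrite mulrCA.
case: (posnP (c * m c)) => [->|]; first by rewrite !mul0r.
rewrite muln_gt0 => /andP[c0 mc]; apply: ler_wpM2l => //.
apply: le_trans (IH (decr m c) _) _.
  by move=> d d0; rewrite /decr subn_gt0 => h1; apply: ha => //; lia.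
rewrite ler_nat; apply: leq_prod => i _.
have e : (\sum_(i < B) i * decr m c i + c = \sum_(i < B) i * m i)%N.
  exact: (@sum_decr B id).
have := ha c c0 mc; rewrite -e; set X := (\sum_(_ < _) _)%N; nia.
Qed.

(** The ratio of the factors of index [i] is [1 - (i + 1) / (S + 1 - i)], at
    most [exp(- (i + 1) / (S + 1))]. *)
Lemma falling_factorial_le_expR (R : realType) S h : (h <= S.+1)%N ->
  (\prod_(i < h) (S - 2 * i))%N%:R <=
  (S.+1 ^_ h)%:R * expR (- ((h * h.+1)%:R / (2 * S.+1%:R))) :> R.
Proof.
elim: h => [|h IH] hS.
  by rewrite big_ord0 ffactn0 mul0n mul0r oppr0 expR0 mulr1.
have -> : - ((h.+1 * h.+2)%:R / (2 * S.+1%:R)) =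
    - ((h * h.+1)%:R / (2 * S.+1%:R)) - h.+1%:R / S.+1%:R :> R.
  have S0 : S.+1%:R != 0 :> R by rewrite pnatr_eq0.
  by rewrite !natrM -!natr1; field; rewrite natr1 S0.
rewrite big_ord_recr /= ffactnSr expRD natrM (natrM _ (S.+1 ^_ h)) mulrACA.
apply: ler_pM; [by []|by []|exact: IH (ltnW hS)|].
have [h1|h1] := leqP S (2 * h).
  by move: h1; rewrite -subn_eq0 => /eqP ->; rewrite mulr_ge0 // expR_ge0.
have Sh : 0 < (S.+1 - h)%:R :> R by rewrite ltr0n subn_gt0.
have -> : (S - 2 * h)%:R =
    (S.+1 - h)%:R * (1 - h.+1%:R / (S.+1 - h)%:R) :> R.
  rewrite mulrBr mulr1 mulrCA divff ?gt_eqF // mulr1.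
  by rewrite -natrB; [congr _%:R; lia|lia].
apply: ler_wpM2l => //; apply: le_trans (expR_ge1Dx _) _.
rewrite ler_expR lerN2 ler_pM2l ?ltr0n // lef_pV2 ?posrE ?ltr0n //.
  by rewrite ler_nat leq_subr.
by rewrite subn_gt0.
Qed.

Lemma marked_forests_le_falling B k S (m : nat -> nat) a h :
    stats_type B S k.+1 m ->
    (forall c, (0 < c)%N -> (0 < m c)%N -> (a <= c)%N) ->
  (marked_forests B S k.+1 m h * S ^_ h <=
   marked_forests B S k.+1 m 0 *
     \prod_(i < h) (\sum_(c < B) c * m c - a * i))%N.
Proof.
move=> hm ha.
rewrite -(ler_nat rat) -bin_ffact mulnA natrM marked_forests_coef //.
rewrite natrM -mulrA; apply: ler_wpM2l => //; rewrite mulrC.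
exact: coef_spine_poly_le.
Qed.

Lemma leq_marked_forests B M k m h h' : (h <= h')%N ->
  (marked_forests B M k m h' <= marked_forests B M k m h)%N.
Proof. by move=> hh; apply: leq_sum => f _; exact: leq_nodes_above. Qed.

(** With [a = 1], the factor of index [S] in the bound vanishes. *)
Lemma marked_forests_high B S m h : stats_type B S.+1 1 m -> (S < h)%N ->
  marked_forests B S.+1 1 m h = 0%N.
Proof.
move=> hm Sh; apply/eqP; rewrite -leqn0.
apply: leq_trans (leq_marked_forests B S.+1 1 m Sh) _.
have := @marked_forests_le_falling _ _ _ _ 1 S.+1 hm (fun c c0 _ => c0).
have [_ _] := hm; rewrite add1n => -[<-].
rewrite big_ord_recr /= mul1n subnn !muln0 leqn0 muln_eq0.
by rewrite -[X in _ || X]leqn0 leqNgt ffact_gt0 leqnn orbF => /eqP ->.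
Qed.

Lemma marked_forests_no_unary (R : realType) B S (m : nat -> nat) h :
    stats_type B S.+1 1 m -> m 1%N = 0%N -> (0 < h <= S)%N ->
  (marked_forests B S.+1 1 m h)%:R <=
  (marked_forests B S.+1 1 m 0)%:R * expR (- (h%:R ^+ 2 / (2 * S%:R))) :> R.
Proof.
move=> hm m1 /andP[h0 hS].
have ha c : (0 < c)%N -> (0 < m c)%N -> (2 <= c)%N.
  by case: c => [|[|c]] //; rewrite m1.
have [_ _] := hm; rewrite add1n => -[eS].
have F0 : 0 < (S.+1 ^_ h)%:R :> R by rewrite ltr0n ffact_gt0 ltnW.
rewrite -(ler_pM2r F0) -(natrM _ _ (S.+1 ^_ h)).
have := marked_forests_le_falling h hm ha; rewrite -eS -(ler_nat R).
move/le_trans; apply; rewrite natrM -mulrA; apply: ler_wpM2l => //.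
apply: le_trans (falling_factorial_le_expR R (leqW hS)) _.
rewrite mulrC; apply: ler_wpM2r => //; rewrite ler_expR lerN2.
have S0 : 0 < S%:R :> R by rewrite ltr0n (leq_trans h0).
rewrite ler_pdivrMr ?mulr_gt0 // mulrAC ler_pdivlMr ?mulr_gt0 ?ltr0n //.
rewrite expr2 -!natrM ler_nat; nia.
Qed.

(** Write [y] for the exponent. The bound [1 + y / 2 <= exp(y / 2)], squared,
    is enough. *)
Lemma expR_ge_quadratic (R : realType) (x : R) : 0 <= x ->
  1 + x <= expR (x - x ^+ 2 / (4 * (1 + x))).
Proof.
move=> x0; have x1 : 0 < 1 + x by lra.
set y := x - _.
have yE : y = x * (4 + 3 * x) / (4 * (1 + x)) by rewrite /y; field; lra.
have y0 : 0 <= y by rewrite yE divr_ge0 ?mulr_ge0 //; lra.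
have -> : y = y / 2 + y / 2 by field.
rewrite expRD; apply: (@le_trans _ _ ((1 + y / 2) * (1 + y / 2))).
  have -> : (1 + y / 2) * (1 + y / 2) =
      1 + x + (x ^+ 2 * (8 * x + 9 * x ^+ 2)) / (64 * (1 + x) ^+ 2).
    by rewrite yE; field; lra.
  by rewrite lerDl divr_ge0 ?mulr_ge0 ?addr_ge0 ?mulr_ge0 ?sqr_ge0.
by apply: ler_pM; rewrite ?addr_ge0 ?divr_ge0 ?expR_ge1Dx.
Qed.

(** This is [|m|_2^2 - m(1)]. *)
Definition branching_sq (B : nat) (m : nat -> nat) : nat :=
  (\sum_(c < B | (1 < c)%N) c ^ 2 * m c)%N.

(** Leaves and unary nodes are treated by [1 + x <= exp x]. A node of degree
    [c >= 2] gains a quadratic term, of size at least [(u c)^2 / (16 (1 + s))]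
    with [s = u sqrt Q], because [c / 2 <= c - 1] and [u c <= s]. *)
Lemma prod_le_expR (R : realType) B S (m : nat -> nat) (u : R) :
    stats_type B S.+1 1 m -> 0 <= u -> u <= 1 ->
  \prod_(c < B) (1 + u * (c%:R - 1)) ^+ m c <=
  expR (- ((u * Num.sqrt (branching_sq B m)%:R - 1) / 16)).
Proof.
set s := u * Num.sqrt _.
move=> hm u0 u1; have [_ h1] := hm; rewrite add1n => -[h2].
have s0 : 0 <= s by rewrite mulr_ge0 ?sqrtr_ge0.
have s2 : s ^+ 2 = u ^+ 2 * (branching_sq B m)%:R.
  by rewrite exprMn sqr_sqrtr.
pose g (c : nat) : R := u * (c%:R - 1) -
  (if (1 < c)%N then (u * c%:R) ^+ 2 / (16 * (1 + s)) else 0).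
apply: (@le_trans _ _ (\prod_(c < B) expR ((m c)%:R * g c))).
  apply: ler_prod => c _.
  have c1 : 0 <= 1 + u * (c%:R - 1).
    have : 0 <= u * c%:R by rewrite mulr_ge0.
    lra.
  rewrite exprn_ge0 //= expRM_natl.
  case: (posnP (m c)) => [->|mc]; first by rewrite !expr0.
  apply: lerXn2r; rewrite ?nnegrE ?expR_ge0 //.
  rewrite /g; case: ifPn => [c2|_]; last by rewrite subr0 expR_ge1Dx.
  have cR : 2 <= c%:R :> R by rewrite ler_nat.
  have ucs : u * c%:R <= s.
    apply: ler_wpM2l => //; rewrite -[leLHS]ger0_norm // -sqrtr_sqr.
    apply: ler_wsqrtr; rewrite -natrX ler_nat /branching_sq (bigD1 c) //=.
    by apply: leq_trans (leq_addr _ _); rewrite leq_pmulr.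
  have x0 : 0 <= u * (c%:R - 1) by rewrite mulr_ge0 //; lra.
  apply: le_trans (expR_ge_quadratic x0) _; rewrite ler_expR lerD2l lerN2.
  have uc : 0 <= u * c%:R by rewrite mulr_ge0.
  have uc2 : u * c%:R / 2 <= u * (c%:R - 1) by rewrite -mulrA ler_wpM2l //; lra.
  have -> : (u * c%:R) ^+ 2 / (16 * (1 + s)) =
      (u * c%:R / 2) ^+ 2 / (4 * (1 + s)) by field; lra.
  apply: ler_pM; rewrite ?sqr_ge0 ?invr_ge0 ?mulr_ge0 //; try lra.
    by apply: lerXn2r; rewrite ?nnegrE //; lra.
  by rewrite lef_pV2 ?posrE; lra.
rewrite -expR_sum ler_expR.
have -> : \sum_(c < B) (m c)%:R * g c =
    - u - s ^+ 2 / (16 * (1 + s)) :> R.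
  transitivity (u * (\sum_(c < B) (c * m c)%:R - \sum_(c < B) (m c)%:R) -
     \sum_(c < B) (if (1 < c)%N then (c ^ 2 * m c)%:R else 0) *
        (u ^+ 2 / (16 * (1 + s)))).
    rewrite -sumrB big_distrr -sumrB /=; apply: eq_bigr => c _.
    by rewrite /g; case: ifP => _; rewrite !natrM; field; lra.
  rewrite s2 /branching_sq -big_distrl -big_mkcond /= -!natr_sum h1 -h2 -natr1.
  by field; lra.
have : (s - 1) / 16 <= s ^+ 2 / (16 * (1 + s)).
  have -> : s ^+ 2 / (16 * (1 + s)) = (s - 1) / 16 + 1 / (16 * (1 + s)).
    by field; lra.
  by rewrite lerDl divr_ge0 //; lra.
lra.
Qed.

(** The choice [u = l / (2 (S + 1))] makes the left factor of
    [marked_forests_le_prod] equal to [1 / 2]. Then [s = u sqrt Q] is at least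
    [g^3 / 3], as [S >= 2] as soon as some node has two children. *)
Lemma marked_forests_tail (R : realType) B S (m : nat -> nat) (g : R) l :
    stats_type B S.+1 1 m -> 4 <= g -> (0 < branching_sq B m)%N ->
    g ^+ 3 * (S%:R / Num.sqrt (branching_sq B m)%:R) < l%:R ->
  (marked_forests B S.+1 1 m l)%:R <=
  (marked_forests B S.+1 1 m 0)%:R * (2 * expR (- (g ^+ 2 / 24))) :> R.
Proof.
move=> hm g4 Q0 hl; have [lS|lS] := leqP l S; last first.
  rewrite (marked_forests_high hm lS) !mulr_ge0 ?expR_ge0 //.
have S2 : (2 <= S)%N.
  have [_ _] := hm; rewrite add1n => -[->].
  move: Q0; rewrite lt0n sum_nat_eq0 negb_forall => /existsP[c].
  rewrite negb_imply muln_eq0 negb_or => /and3P[c1 _ mc].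
  rewrite (bigD1 c) //= (leq_trans c1) // (leq_trans _ (leq_addr _ _)) //.
  by rewrite leq_pmulr // lt0n.
set q := Num.sqrt (branching_sq B m)%:R in hl.
have q0 : 0 < q by rewrite sqrtr_gt0 ltr0n.
have S2R : 2 <= S%:R :> R by rewrite ler_nat.
have {}hl : g ^+ 3 * S%:R < l%:R * q by rewrite -ltr_pdivrMr // -mulrA.
have g2 : 0 < g ^+ 2 by rewrite exprn_gt0 //; lra.
have g3 : 3 + 2 * g ^+ 2 <= g ^+ 3.
  have : 16 <= g ^+ 2.
    rewrite (_ : 16 = 4 ^+ 2); last by ring.
    by apply: lerXn2r; rewrite ?nnegrE //; lra.
  have : 0 <= g ^+ 2 * (g - 4) by rewrite mulr_ge0 //; lra.
  by rewrite (exprS g 2); nra.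
have l0 : 0 < l%:R :> R.
  by rewrite -(pmulr_lgt0 _ q0) (le_lt_trans _ hl) // mulr_ge0 //; lra.
have l0' : (0 < l)%N by rewrite -(ltr0n R).
have SS : S.+1%:R = S%:R + 1 :> R by rewrite natr1.
set u : R := l%:R / (2 * S.+1%:R).
have u0 : 0 <= u by rewrite divr_ge0 ?mulr_ge0.
have u1 : u <= 1 / 2.
  rewrite /u ler_pdivrMr ?mulr_gt0 ?ltr0n // SS.
  by have : l%:R <= S%:R :> R; [rewrite ler_nat|lra].
have u1' : u < 1 by lra.
have := marked_forests_le_prod hm u0 u1' l0'.
have -> : 1 - S.+1%:R * u / l%:R = 1 / 2 :> R.
  by rewrite /u SS; field; apply/andP; split; lra.
move=> h1; have h2 := prod_le_expR hm u0 (ltW u1').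
rewrite -/q in h2.
have h3 : g ^+ 3 / 3 <= u * q.
  have -> : u * q = l%:R * q / (2 * S.+1%:R) by rewrite /u; ring.
  rewrite ler_pdivlMr ?mulr_gt0 ?ltr0n // SS.
  apply: le_trans (ltW hl).
  have : 0 <= g ^+ 3 * (S%:R - 2) by rewrite mulr_ge0 //; lra.
  by nra.
rewrite -(ler_pM2r (_ : 0 < 1 / 2 :> R)); last by lra.
apply: le_trans h1 _; rewrite -mulrA; apply: ler_wpM2l => //.
apply: le_trans h2 _.
have -> x : 2 * x * (1 / 2) = x :> R by field.
rewrite ler_expR; lra.
Qed.

(** * Uniform pointed trees *)

(** Only the singletons are known to be measurable, so the event is cut into
    the finitely many values that it allows. *)
Lemma uniformly_random_count (R : realType) (d : measure_display)
    (Omega : measurableType d) (P : probability Omega R) (E : choiceType)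
    (L : seq E) (S : set E) (X : Omega -> E) (A : pred E) :
  uniq L -> S = [set` L] -> uniformly_random P S X ->
  P [set w | A (X w)] = ((count A L)%:R / (size L)%:R)%:E.
Proof.
move=> uL SL [SX hX].
have cardS : #|` fset_set S| = size L.
  apply/eqP; rewrite eqn_leq SL.
  have /perm_size -> : perm_eq (fset_set [set` L]) L.
    apply: uniq_perm => // x.
    rewrite in_fset_set; last exact: finite_seq.
    by apply/idP/idP; rewrite inE.
  by rewrite leqnn.
rewrite cardS in hX.
have main (L' : seq E) : uniq L' -> {subset L' <= L} ->
    measurable [set w | X w \in L'] /\
    P [set w | X w \in L'] = ((size L')%:R / (size L)%:R)%:E.
  elim: L' => [|x L' IH] /=.
    move=> _ _; rewrite [X in measurable X](_ : _ = set0) ?mul0r.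
      split; first exact: measurable0.
      by rewrite (_ : mkset _ = set0) ?measure0 // -subset0.
    by rewrite -subset0.
  move=> /andP[xL' uL'] sub.
  have [m1 p1] : measurable (X @^-1` [set x]) /\
      P (X @^-1` [set x]) = ((size L)%:R^-1)%:E.
    by apply: hX; rewrite SL /=; apply: sub; rewrite mem_head.
  have [m2 p2] := IH uL' (fun y yL => sub y (mem_behead (s := x :: L') yL)).
  have -> : [set w | X w \in x :: L'] =
      X @^-1` [set x] `|` [set w | X w \in L'].
    apply/seteqP; split=> w /=; rewrite inE.
      by case/orP => [/eqP|]; [left|right].
    by case=> [->|->]; rewrite ?eqxx ?orbT.
  split; first exact: measurableU.
  have disj : X @^-1` [set x] `&` [set w | X w \in L'] = set0.
    by rewrite -subset0 => w [/= ->]; rewrite (negPf xL').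
  transitivity (P (X @^-1` [set x]) + P [set w | X w \in L'])%E.
    exact: measureU.
  by rewrite p1 p2 -EFinD -natr1 mulrDl mul1r addrC.
have -> : [set w | A (X w)] = [set w | X w \in [seq x <- L | A x]].
  apply/seteqP; split=> w /=; rewrite mem_filter; last by case/andP.
  by move=> ->; have := SX w; rewrite SL.
have [||_ ->] := main ([seq x <- L | A x]); first exact: filter_uniq.
  by move=> x; rewrite mem_filter => /andP[].
by rewrite size_filter.
Qed.

(** Every node other than the [k] roots is the child of exactly one node. *)
Lemma total_forests B M k m f :
    (forall c, (B <= c)%N -> m c = 0%N) -> (\sum_(c < B) m c = M)%N ->
  f \in forests B M k m -> (M = k + \sum_(c < B) c * m c)%N.
Proof.
elim: M k m f => [|M IH] [|k] m f hB hM //=.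
  move=> _; rewrite add0n big1 // => c _.
  by move/eqP: hM; rewrite sum_nat_eq0 => /forallP/(_ c) /= /eqP ->;
    rewrite muln0.
move=> /allpairsPdep[c [g [+ gf _]]].
rewrite mem_filter mem_iota add0n => /andP[mc /andP[_ cB]].
have := IH _ _ _ (decr_bounded c hB) (total_decr cB mc hM) gf.
have h : (\sum_(i < B) i * decr m c i + c = \sum_(i < B) i * m i)%N.
  exact: (@sum_decr B id).
by move=> ->; rewrite -h addSn -addnA [(c + _)%N]addnC.
Qed.

Lemma degree_stats_type n : is_degree_stats n ->
  exists B S, stats_type B S.+1 1 n.
Proof.
move=> [t ht]; pose B := (\max_(v <- nodes t) degree t v).+1.
have hB c : (B <= c)%N -> n c = 0%N.
  move=> Bc; rewrite -ht /degree_stats_of.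
  apply/eqP; rewrite -leqn0 leqNgt -has_count; apply/hasPn => v vt.
  by rewrite ltn_eqF // (leq_trans _ Bc) // ltnS; apply: leq_bigmax_seq.
have tf : [:: t] \in forests B (\sum_(c < B) n c)%N 1 n.
  apply/mem_forests => //; split=> // c.
  by rewrite /forest_stats big_seq1.
have e := total_forests hB erefl tf.
by exists B, (\sum_(c < B) c * n c)%N; split => //; rewrite e.
Qed.

Definition pointed_list (B N : nat) (n : nat -> nat) :
    seq (plane_tree * node) :=
  [seq (head (PNode [::]) f, v) |
    f <- forests B N 1 n, v <- nodes (head (PNode [::]) f)].

Lemma pointed_listE B N n : stats_type B N 1 n ->
  pointed_plane_trees n = [set` pointed_list B N n].
Proof.
move=> [hB hN _]; apply/seteqP; split=> -[t v] /=.
  move=> [ht vt]; apply/allpairsPdep; exists [:: t], v; split=> //.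
  apply/mem_forests => //; split=> // c.
  by rewrite /forest_stats big_seq1; exact: ht.
move=> /allpairsPdep[f [w [+ hw [-> ->]]]].
rewrite mem_forests // => -[].
case: f hw => [|t' [|//]] //= hw _ hf; split=> // c /=.
by rewrite -hf /forest_stats big_seq1.
Qed.

Lemma uniq_pointed_list B N n : stats_type B N 1 n ->
  uniq (pointed_list B N n).
Proof.
move=> [hB hN _]; apply: allpairs_uniq_dep; first exact: uniq_forests.
  by move=> f _; exact: uniq_nodes.
move=> [f v] [f' v'] /allpairsPdep[g [x [+ _ [-> _]]]].
move=> + /allpairsPdep[g' [x' [+ _ [-> _]]]] /=.
rewrite !mem_forests // => -[+ _] [+ _].
by case: g => [|t []] //; case: g' => [|t' []] //= _ _ [-> ->].
Qed.

Lemma count_pointed_list B N n l :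
  count (fun tv => (l <= height tv.2)%N) (pointed_list B N n) =
  marked_forests B N 1 n l.
Proof.
rewrite -sum1_count big_mkcond big_allpairs_dep /=; apply: eq_bigr => f _.
by rewrite -big_mkcond sum1_count.
Qed.

Lemma size_pointed_list B N n :
  size (pointed_list B N n) = marked_forests B N 1 n 0.
Proof.
by rewrite -count_pointed_list -[LHS]count_predT.
Qed.

(** * Norms of degree statistics *)

Lemma limn_series_finite (R : realType) B (u : nat -> R) :
  (forall c, (B <= c)%N -> u c = 0) -> limn (series u) = \sum_(c < B) u c.
Proof.
move=> hu; apply: lim_near_cst => //; near=> k.
rewrite /series /= -(subnKC (_ : B <= k)%N); last first.
  by near: k; exact: nbhs_infty_ge.
rewrite (big_cat_nat (leq0n B)) ?leq_addr //= [X in _ + X]big1_seq ?addr0.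
  by rewrite big_mkord.
by move=> i /andP[_]; rewrite mem_index_iota => /andP[/hu].
Unshelve. all: by end_near.
Qed.

Lemma pnorm1E (R : realType) B N (n : nat -> nat) : stats_type B N 1 n ->
  pnorm (1 : R) n = (\sum_(c < B) c * n c)%N%:R.
Proof.
move=> [hB _ _]; rewrite /pnorm (@limn_series_finite _ B); last first.
  by move=> c /hB ->; rewrite mulr0.
rewrite invr1 powRr1; last first.
  by apply: sumr_ge0 => c _; rewrite mulr_ge0 ?powR_ge0.
by rewrite natr_sum; apply: eq_bigr => c _; rewrite powRr1 // natrM.
Qed.

Lemma pnorm2E (R : realType) B N (n : nat -> nat) : stats_type B N 1 n ->
  pnorm (2 : R) n ^+ 2 - (n 1%N)%:R = (branching_sq B n)%:R.
Proof.
move=> [hB _ _]; rewrite /pnorm (@limn_series_finite _ B); last first.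
  by move=> c /hB ->; rewrite mulr0.
have s0 : 0 <= \sum_(c < B) c%:R `^ 2 * (n c)%:R :> R.
  by apply: sumr_ge0 => c _; rewrite mulr_ge0 ?powR_ge0.
rewrite powR12_sqrt // sqr_sqrtr //.
apply/eqP; rewrite subr_eq -natrD; apply/eqP.
transitivity ((\sum_(c < B) c ^ 2 * n c)%N%:R : R).
  rewrite natr_sum; apply: eq_bigr => c _.
  by rewrite -[2]/(2%:R) powR_mulrn // natrM natrX.
congr _%:R; rewrite /branching_sq (bigID (fun c : 'I_B => (1 < c)%N)) /=.
congr addn; have [B1|B1] := leqP B 1.
  rewrite (hB 1%N) // big1 // => c _.
  have := ltn_ord c; case: (val c) => //; lia.
rewrite (bigD1 (Ordinal B1)) //= exp1n mul1n big1 ?addn0 // => c.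
by rewrite -(inj_eq val_inj) /=; case: (val c) => [|[|c']].
Qed.

(** * Tails of the height of a uniform pointed node *)

Lemma height_tail (R : realType) B N (n : nat -> nat) (d : measure_display)
    (Omega : measurableType d) (P : probability Omega R)
    (T : Omega -> plane_tree) (V : Omega -> node) l :
  stats_type B N 1 n ->
  uniformly_random P (pointed_plane_trees n) (fun w => (T w, V w)) ->
  P [set w | (l <= height (V w))%N] =
  ((marked_forests B N 1 n l)%:R / (marked_forests B N 1 n 0)%:R)%:E.
Proof.
move=> hn hTV; rewrite -count_pointed_list -size_pointed_list.
exact: (uniformly_random_count (fun tv => (l <= height tv.2)%N)
  (uniq_pointed_list hn) (pointed_listE hn) hTV).
Qed.

Theorem theorem1p1 (R : realType) (n : nat -> nat) (hn : is_degree_stats n)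
    (d : measure_display) (Omega : measurableType d) (P : probability Omega R)
    (T : Omega -> plane_tree) (V : Omega -> node)
    (hTV : uniformly_random P (pointed_plane_trees n) (fun w => (T w, V w))) :
  (forall beta : R, 17 `^ (3 / 2) < beta ->
    (P [set w | beta%:E * height_scale R n < (height (V w))%:R%:E]
     <= expeR (- ((beta `^ (1 / 3) / 3)%:E * height_scale R n))
        + 2%:E * expeR (- (beta `^ (2 / 3) / 24)%:E))%E)
  /\
  (n 1%N = 0%N -> forall l : nat, (1 <= l)%N ->
    (P [set w | (l <= height (V w))%N]
     <= expeR (- quot_oo (l%:R ^+ 2) (2 * pnorm 1 n)))%E).
Proof.
have [B [S hS]] := degree_stats_type hn.
have tail l := height_tail l hS hTV.
have w0 : 0 < (marked_forests B S.+1 1 n 0)%:R :> R.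
  rewrite ltr0n lt0n; apply/eqP => h.
  by have := marked_forests0 hS; rewrite h mul0n => /esym/eqP;
    rewrite -leqn0 leqNgt fact_gt0.
have p1 : pnorm (1 : R) n = S%:R.
  by rewrite (pnorm1E R hS); have [_ _] := hS; rewrite add1n => -[<-].
split=> [beta hbeta|n1 l l1]; last first.
  rewrite tail p1 /quot_oo.
  have [lS|lS] := leqP l S; last first.
    by rewrite (marked_forests_high hS lS) mul0r expeR_ge0.
  have S0 : S%:R != 0 :> R by rewrite pnatr_eq0; lia.
  rewrite mulf_eq0 (negPf S0) orbF pnatr_eq0 /= lee_fin ler_pdivrMr // mulrC.
  by apply: marked_forests_no_unary => //; rewrite l1.
have beta0 : 0 < beta by apply: le_lt_trans hbeta; exact: powR_ge0.
rewrite /height_scale p1 (pnorm2E R hS) /quot_oo.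
have [Q0|Q0] := posnP (branching_sq B n).
  rewrite Q0 sqrtr0 eqxx gt0_muley ?lte_fin // [X in P X](_ : _ = set0).
    by rewrite measure0 adde_ge0 ?mule_ge0 ?expeR_ge0 ?lee_fin.
  by rewrite -subset0.
rewrite sqrtr_eq0 lern0 eqn0Ngt Q0 /=.
set g := beta `^ (1 / 3).
have g3 : g ^+ 3 = beta.
  rewrite -powR_mulrn ?powR_ge0 // -powRrM (_ : _ * _ = 1); last by field.
  by rewrite powRr1 ?ltW.
have g2 : beta `^ (2 / 3) = g ^+ 2.
  by rewrite -powR_mulrn ?powR_ge0 // -powRrM; congr (_ `^ _); field.
have g4 : 4 <= g.
  have : 17 < g ^+ 2.
    have -> : 17 = (17 `^ (3 / 2)) `^ (2 / 3) :> R.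
      by rewrite -powRrM (_ : _ * _ = 1) ?powRr1 //; field.
    by rewrite -g2; apply: gt0_ltr_powR; rewrite ?nnegrE ?powR_ge0 ?ltW //; lra.
  have : 0 <= g by exact: powR_ge0.
  by rewrite expr2; nra.
rewrite g2.
set x := beta * (S%:R / Num.sqrt (branching_sq B n)%:R).
have x0 : 0 <= x by rewrite mulr_ge0 ?divr_ge0 ?sqrtr_ge0 ?(ltW beta0).
have -> : [set w | (beta%:E * (S%:R / Num.sqrt (branching_sq B n)%:R)%:E
      < (height (V w))%:R%:E)%E] =
    [set w | ((Num.trunc x).+1 <= height (V w))%N].
  by apply/seteqP; split=> w /=; rewrite -EFinM lte_fin truncn_lt_nat.
rewrite tail.
(* The second term of the announced bound is large enough by itself. *)
apply: (@le_trans _ _ (2%:E * expeR (- (g ^+ 2 / 24)%:E))%E); last first.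
  by rewrite leeDr ?expeR_ge0.
rewrite /= lee_fin ler_pdivrMr // mulrC.
apply: marked_forests_tail => //; rewrite g3 -/x.
by rewrite -truncn_lt_nat.
Qed.
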